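(* Let $R$ be a right perfect ring and $M$ be a right $R$-module. Then the following are equivalent. (1) $M$ is projective. (2) $M$ is $R$-projective. (3) $M$ is max-projective.
   Context: Rings are associative with identity; modules are unital right modules. A right $R$-module $M$ is $R$-projective if for every right ideal $I$ of $R$, every homomorphism $M\to R/I$ factors through the canonical projection $R\to R/I$. $M$ is max-projective if this holds for every maximal right ideal $I$ of $R$. A ring is right perfect if every right module has a projective cover. *)

(* Defs.v *)
From HB Require Import structures.
From mathcomp Require Import all_boot all_algebra.

Set Implicit Arguments.
Unset Strict Implicit.
Unset Printing Implicit Defensive.

Import GRing.Theory.
Local Open Scope ring_scope.
Local Open Scope quotient_scope.

(* Right R-modules are left modules over the converse ring R^c. In the module *)
(* (R^c)^o of R acting on itself, a *: x is the product x * a of R, so that   *)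
(* (R^c)^o is the right module R_R and its submodules are the right ideals.   *)
(* Module carriers are choiceTypes and submodules are boolean predicates;     *)
(* with excluded middle and choice neither is a restriction.                  *)
Notation rmodType R := (lmodType (R : pzRingType)^c).
Notation right_ideal R := (submodClosed ((R : pzRingType)^c)^o).

(* The library only quotients by a zmodClosed predicate, and a submodClosed   *)
(* one is not canonically zmodClosed: submod_pred I is I with that structure. *)
Section QuotientModule.
Variables (A : pzRingType) (V : lmodType A) (I : submodClosed V).

Definition submod_pred : {pred V} := [pred x in I].

Fact submod_pred_zmod_closed : zmod_closed submod_pred.
Proof.
split=> [|x y Ix Iy]; first exact: (rpred0 I).
by rewrite -scaleN1r; apply: (rpredD (S := I)) => //; apply: (rpredZ (s := I)).
Qed.

HB.instance Definition _ :=
  GRing.isZmodClosed.Build V submod_pred submod_pred_zmod_closed.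

Definition quot_mod : Type := Quotient.quot (submod_pred : zmodClosed V).

HB.instance Definition _ := GRing.Zmodule.on quot_mod.
HB.instance Definition _ := EqQuotient.on quot_mod.

Lemma quot_modE (x y : V) : (\pi_quot_mod x == \pi_quot_mod y) = (x - y \in I).
Proof.
exact/esym/(Quotient.idealrBE (submod_pred : zmodClosed V)).
Qed.

Definition quot_scale (a : A) (u : quot_mod) : quot_mod :=
  \pi_quot_mod (a *: repr u).

Lemma pi_scale a x : quot_scale a (\pi_quot_mod x) = \pi_quot_mod (a *: x).
Proof.
apply/eqP; rewrite quot_modE -scalerBr; apply: (rpredZ (s := I)).
by rewrite -quot_modE reprK.
Qed.

Lemma pi_quot_modD x y :
  \pi_quot_mod (x + y) = \pi_quot_mod x + \pi_quot_mod y.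
Proof. exact: (raddfD \pi_(Quotient.quot (submod_pred : zmodClosed V))). Qed.

Fact quot_scaleA a b u : quot_scale a (quot_scale b u) = quot_scale (a * b) u.
Proof. by elim/quotW: u => x; rewrite (pi_scale b) !pi_scale scalerA. Qed.

Fact quot_scale1 : left_id 1 quot_scale.
Proof. by elim/quotW=> x; rewrite pi_scale scale1r. Qed.

Fact quot_scaleDr : right_distributive quot_scale +%R.
Proof.
move=> a; elim/quotW=> x; elim/quotW=> y.
by rewrite -pi_quot_modD !pi_scale scalerDr pi_quot_modD.
Qed.

Fact quot_scaleDl u : {morph quot_scale^~ u : a b / a + b}.
Proof.
by elim/quotW: u => x a b; rewrite !pi_scale scalerDl pi_quot_modD.
Qed.

HB.instance Definition _ := GRing.Zmodule_isLmodule.Build A quot_mod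
  quot_scaleA quot_scale1 quot_scaleDr quot_scaleDl.

Definition quot_proj (x : V) : quot_mod := \pi_quot_mod x.

Fact quot_proj_linear : linear quot_proj.
Proof. by move=> a x y; rewrite /quot_proj pi_quot_modD -pi_scale. Qed.

HB.instance Definition _ :=
  GRing.isLinear.Build A V quot_mod *:%R quot_proj quot_proj_linear.

Lemma quot_proj_eq0 x : (quot_proj x == 0) = (x \in I).
Proof. by rewrite -(raddf0 quot_proj) quot_modE subr0. Qed.

End QuotientModule.

Definition surj (A B : Type) (g : A -> B) : Prop := forall b, exists a, g a = b.

Lemma quot_proj_surj (A : pzRingType) (V : lmodType A) (I : submodClosed V) :
  surj (quot_proj I).
Proof. by elim/quotW=> x; exists x. Qed.

Definition superfluous (A : pzRingType) (V : lmodType A) (K : {pred V}) : Prop :=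
  forall N : submodClosed V,
    (forall v, exists k n, [/\ k \in K, n \in N & v = k + n]) -> N =i predT.

Section RightModules.
Variable R : pzRingType.
Implicit Type M : rmodType R.

Definition projective M : Prop :=
  forall (A B : rmodType R) (g : {linear A -> B}) (f : {linear M -> B}),
    surj g -> exists h : {linear M -> A}, forall x, g (h x) = f x.

Definition projective_cover (P M : rmodType R) (p : {linear P -> M}) : Prop :=
  [/\ projective P, surj p & superfluous [pred x | p x == 0]].

Definition right_perfect : Prop :=
  forall M, exists (P : rmodType R) (p : {linear P -> M}), projective_cover p.

Definition lifts_modulo M (I : right_ideal R) : Prop :=
  forall f : {linear M -> quot_mod I},
    exists h : {linear M -> (R^c)^o}, forall x, quot_proj I (h x) = f x.

Definition maximal_right_ideal (I : right_ideal R) : Prop :=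
  ~ (I =i predT) /\
  forall J : right_ideal R, {subset I <= J} -> J =i I \/ J =i predT.

Definition R_projective M : Prop := forall I : right_ideal R, lifts_modulo M I.

Definition max_projective M : Prop :=
  forall I : right_ideal R, maximal_right_ideal I -> lifts_modulo M I.

End RightModules.

(* Main.v *)
From HB Require Import structures.
From mathcomp Require Import all_boot all_algebra.
From mathcomp Require Import boolp classical_sets functions.
Require Import Defs.

Set Implicit Arguments.
Unset Strict Implicit.
Unset Printing Implicit Defensive.

Import GRing.Theory.
Local Open Scope ring_scope.

(** Over a right perfect ring R, let M be max-projective and let p : P -> M be
    a projective cover.  It is enough to see that p is injective, for then M is
    isomorphic to P.

    Let J be the Jacobson radical of R.  The heart of the matter is that every
    linear functional g : P -> R agrees modulo J with one that factors through
    p (functional_factors_mod_jacobson).  Granted this, let p x = 0.  By the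
    dual basis lemma, x = sum_j y_j g_j(x) for finitely many y_j in P and
    functionals g_j.  If h_i o p is congruent to g_i modulo J, then
    g_i(x) = g_i(x) - h_i(p x) = sum_j d_ij g_j(x)
    where d_ij = g_i(y_j) - h_i(p y_j) lies in J.  By Nakayama's lemma all the
    g_j(x) vanish, so x = 0 (cover_of_max_projective_inj).

    To approximate functionals modulo J, consider the right ideal T of those t
    such that, for each g, the functional t g agrees modulo J with one that
    factors through p.  If 1 is not in T, then T lies in a maximal right ideal
    I.  The kernel of p is superfluous, so it is killed by every map from P to
    the simple module R/I (superfluous_quot_maximal); hence g modulo I induces
    a map M -> R/I, and max-projectivity lifts it to h : M -> R with g - h o p
    valued in I.  The projective cover of R/I provides e with 1 - e in I and
    e I contained in J (cover_complement_ideal).  So e g - e h o p is valued in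
    J, whence e belongs to T, hence to I, and so does 1: a contradiction. *)

(** * Submodules, factorization of linear maps, and the regular module *)

Section PropSubmodule.
Variables (A : pzRingType) (V : lmodType A).

Definition submodule_prop (X : V -> Prop) : Prop :=
  X 0 /\ forall a u v, X u -> X v -> X (a *: u + v).

(** The proof of closure is an argument, so that instance resolution finds the
    submodule structure from the term itself. *)
Definition prop_submod (X : V -> Prop) of submodule_prop X : {pred V} :=
  fun x => `[< X x >].

Variables (X : V -> Prop) (subX : submodule_prop X).

Lemma prop_submodP x : reflect (X x) (x \in prop_submod subX).
Proof. exact: asboolP. Qed.

Fact prop_submod_closed : submod_closed (prop_submod subX).
Proof.
case: (subX) => X0 XD; split=> [|a u v /prop_submodP Xu /prop_submodP Xv].
  exact/prop_submodP.
exact/prop_submodP/XD.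
Qed.

HB.instance Definition _ :=
  GRing.isSubmodClosed.Build A V (prop_submod subX) prop_submod_closed.

Definition submod_of_prop : submodClosed V := prop_submod subX.

Lemma submod_of_propP x : reflect (X x) (x \in submod_of_prop).
Proof. exact: prop_submodP. Qed.

End PropSubmodule.

Section SubmoduleType.
Variables (A : pzRingType) (V : lmodType A) (S : submodClosed V).

Definition submod_type : Type := {v | v \in S}.

HB.instance Definition _ := SubType.on submod_type.
HB.instance Definition _ := [Choice of submod_type by <:].
HB.instance Definition _ := [SubChoice_isSubLmodule of submod_type by <:].

End SubmoduleType.

Section Linear.
Variable A : pzRingType.
Implicit Types M P Q : lmodType A.

(** The values on the fibers of p make the composite of f with any set-theoretic
    section of p independent of the section, hence linear. *)
Lemma linear_factor P M Q (p : {linear P -> M}) (f : {linear P -> Q}) :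
  surj p -> (forall x, p x = 0 -> f x = 0) ->
  exists g : {linear M -> Q}, forall x, g (p x) = f x.
Proof.
move=> p_surj kerpf.
have [s sK] := boolp.choice p_surj.
have gp x : f (s (p x)) = f x.
  apply/eqP; rewrite -subr_eq0 -raddfB.
  by apply/eqP/kerpf; rewrite raddfB /= sK subrr.
have g_lin : linear (f \o s).
  move=> a u v; rewrite /= -{1}(sK u) -{1}(sK v) -linearP gp; exact: linearP.
pose g := GRing.isLinear.Build A M Q *:%R (f \o s) g_lin.
by exists (HB.pack_for {linear M -> Q} (f \o s) g).
Qed.

End Linear.

Notation regular_rmod R := ((R : pzRingType)^c)^o.

Section Regular.
Variable R : pzRingType.
Local Notation RR := (regular_rmod R).

Lemma scale_regularE (a x : R) : (a : R^c) *: (x : RR) = x * a :> R.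
Proof. by []. Qed.

Lemma linear_regularZ (M : rmodType R) (g : {linear M -> RR}) (a : R) x :
  g ((a : R^c) *: x) = (g x : R) * a :> R.
Proof. by rewrite linearZ. Qed.

Definition lmul (r : R) (x : RR) : RR := r * (x : R).

Fact lmul_linear r : linear (lmul r).
Proof. by move=> a x y; rewrite /lmul mulrDr !scale_regularE mulrA. Qed.

HB.instance Definition _ r :=
  GRing.isLinear.Build (R^c) RR RR *:%R (lmul r) (lmul_linear r).

(** R_R is free on 1; a map out of R_R is thus lifted along a surjection by
    lifting the image of 1. *)
Lemma regular_free (M : rmodType R) (y : M) :
  exists s : {linear RR -> M}, forall x : R, s x = (x : R^c) *: y.
Proof.
pose s0 (x : RR) := (x : R^c) *: y.
have s0_lin : linear s0 by move=> a u v; rewrite /s0 scalerDl scalerA.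
pose s := HB.pack_for {linear RR -> M} s0
  (GRing.isLinear.Build (R^c) RR M *:%R s0 s0_lin).
by exists s.
Qed.

Lemma right_idealMr (I : right_ideal R) (x a : R) : x \in I -> x * a \in I.
Proof. exact: (rpredZ (s := I) (a : R^c)). Qed.

Lemma right_ideal1 (I : right_ideal R) : 1 \in I -> forall x : R, x \in I.
Proof. by move=> I1 x; rewrite -[x]mul1r; apply: right_idealMr. Qed.

End Regular.

(** * The Jacobson radical and Nakayama's lemma *)

Section QuasiRegular.
Variable R : pzRingType.
Implicit Types a j k r : R.

(** The quasi-regular description of the Jacobson radical: j lies in it exactly
    when the right ideal j R is superfluous in R. *)
Definition jacobson j : Prop := forall r, exists u, (1 - j * r) * u = 1.

Lemma jacobson0 : jacobson 0.
Proof. by move=> r; exists 1; rewrite mul0r subr0 mulr1. Qed.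

Lemma jacobsonMr j a : jacobson j -> jacobson (j * a).
Proof. by move=> Jj r; have [u uE] := Jj (a * r); exists u; rewrite -mulrA. Qed.

Lemma jacobsonD j k : jacobson j -> jacobson k -> jacobson (j + k).
Proof.
move=> Jj Jk r; have [u uE] := Jj r; have [v vE] := Jk (r * u).
exists (u * v); rewrite mulrA [(j + k) * r]mulrDl opprD addrA mulrDl uE.
by rewrite mulNr -(mulrA k).
Qed.

(** If 1 - b a has the right inverse u then 1 - a b has the right inverse
    1 + a u b; here b = j r. *)
Lemma jacobsonMl j a : jacobson j -> jacobson (a * j).
Proof.
move=> Jj r; have [u uE] := Jj (r * a); exists (1 + a * (u * (j * r))).
have auE : (1 - a * j * r) * a = a * (1 - j * (r * a)).
  by rewrite mulrBl mulrBr mul1r mulr1 !mulrA.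
by rewrite mulrDr mulr1 mulrA auE -!mulrA (mulrA _ u) uE mul1r !mulrA subrK.
Qed.

(** A right inverse u of 1 - j equals 1 + j u, so it has a right inverse too;
    u is thus invertible, with inverse 1 - j. *)
Lemma jacobson_linv j : jacobson j -> exists u, u * (1 - j) = 1.
Proof.
move=> Jj; have [u] := Jj 1; rewrite mulr1 => uE; exists u.
have [v vE] := Jj (- u).
have uE' : u = 1 - j * - u.
  by rewrite mulrN opprK -[LHS]mul1r -{1}(subrK j 1) mulrDl uE.
have uv1 : u * v = 1 by rewrite uE'.
by rewrite (_ : 1 - j = v) // -[LHS]mulr1 -{2}uv1 mulrA uE mul1r.
Qed.

(** Nakayama's lemma for the left ideal spanned by the a_i, in matrix form: if
    D has entries in J then 1 - D is left invertible.  Gaussian elimination: the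
    last equation expresses a_n through the others, since 1 - d_nn is a unit,
    and substituting it only changes the other coefficients within J. *)
Lemma jacobson_nakayama n (a : nat -> R) (d : nat -> nat -> R) :
  (forall i k : nat, (i < n)%N -> (k < n)%N -> jacobson (d i k)) ->
  (forall i, (i < n)%N -> a i = \sum_(k < n) d i k * a k) ->
  forall i, (i < n)%N -> a i = 0.
Proof.
elim: n a d => [//|n IHn] a d Jd aE.
have [u uE] := jacobson_linv (Jd n n (ltnSn n) (ltnSn n)).
have anE : a n = \sum_(k < n) u * d n k * a k.
  rewrite -[LHS]mul1r -uE -mulrA mulrBl mul1r {1}aE // big_ord_recr /= addrK.
  by rewrite mulr_sumr; apply: eq_bigr => k _; rewrite mulrA.
have a0 i : (i < n)%N -> a i = 0.
  pose d' i l := d i l + d i n * (u * d n l).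
  apply: (IHn a d') => [{}i k lin lkn|{}i lin].
    apply: jacobsonD; first by apply: Jd; apply: ltnW.
    by apply: jacobsonMr; apply: Jd => //; apply: ltnW.
  rewrite {1}aE ?ltnS ?(ltnW lin) // big_ord_recr /= {1}anE mulr_sumr.
  rewrite -big_split /=.
  by apply: eq_bigr => k _; rewrite /d' mulrDl !mulrA.
move=> i; rewrite ltnS leq_eqVlt => /orP[/eqP->|/a0//].
by rewrite anE big1 // => k _; rewrite a0 ?mulr0.
Qed.

End QuasiRegular.

(** * Maximal right ideals and superfluous kernels *)

Section MaximalIdeals.
Variable R : pzRingType.
Local Notation RR := (regular_rmod R).

Local Open Scope classical_set_scope.

Lemma maximal_right_ideal_above (T : right_ideal R) : 1 \notin T ->
  exists2 I : right_ideal R, maximal_right_ideal I & {subset T <= I}.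
Proof.
move=> T1.
pose proper (X : set RR) := submodule_prop X /\ ~ X (1 : R).
pose T' : set RR := [set x | x \in T].
have T'proper : proper T'.
  split; last exact/negP.
  split=> [|a u v]; first exact: (rpred0 T).
  by move=> Tu Tv; apply: (rpredD (S := T)) => //; apply: (rpredZ (s := T)).
(* Joining T to X makes the empty set admissible, so that the union of the
   empty chain is admissible as well. *)
pose P (X : set RR) := proper (T' `|` X).
have [F FP Ftot|X [PX Xmax]] := @Zorn_bigcup RR P.
  have [[X0 FX0]|F0] := pselect (exists X, F X); last first.
    suff -> : \bigcup_(X in F) X = set0 by rewrite /P setU0.
    by rewrite -subset0 => x [X FX]; case: F0; exists X.
  split; last first.
    case=> [T1'|[X FX X1]]; first by case: T'proper => _.
    by case: (FP _ FX) => _; apply; right.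
  split; first by left; exact: (rpred0 T).
  have inF x : (T' `|` \bigcup_(X in F) X) x -> exists2 X, F X & (T' `|` X) x.
    by case=> [Tx|[X FX Xx]]; [exists X0 => //; left | exists X => //; right].
  have Fin X x : F X -> (T' `|` X) x -> (T' `|` \bigcup_(X in F) X) x.
    by move=> FX [Tx|Xx]; [left | right; exists X].
  move=> a u v /inF[X FX Xu] /inF[Y FY Yv].
  have [XY|YX] := Ftot _ _ FX FY.
    apply: (Fin Y) => //; case: (FP _ FY) => [[_ YD] _]; apply: YD => //.
    by case: Xu => [|/XY]; [left | right].
  apply: (Fin X) => //; case: (FP _ FX) => [[_ XD] _]; apply: XD => //.
  by case: Yv => [|/YX]; [left | right].
case: PX => subX X1.
exists (submod_of_prop subX); last by move=> x Tx; apply/submod_of_propP; left.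
split=> [IT|J IJ].
  by apply: X1; apply/(submod_of_propP subX); rewrite IT.
have [J1|J1] := boolP ((1 : R) \in J).
  by right=> x; exact: right_ideal1 J1 x.
left=> x; apply/idP/idP => [Jx|/IJ//].
have Jsub : X `<=` [set y | y \in J].
  by move=> y Xy; apply/IJ/submod_of_propP; right.
apply/submod_of_propP; right; apply: contrapT => Xx.
apply: (Xmax [set y | y \in J]).
  by split=> // /(_ x Jx).
have TJ : T' `|` [set y | y \in J] = [set y | y \in J].
  apply/seteqP; split=> [y [Ty|//]|y]; last by right.
  by apply/IJ/submod_of_propP; left.
rewrite /P TJ; split; last exact/negP.
split=> [|a u v]; first exact: (rpred0 J).
by move=> Ju Jv; apply: (rpredD (S := J)) => //; apply: (rpredZ (s := J)).
Qed.

(** R/I is simple: the right ideal of the x whose class is a multiple of the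
    class of y contains I, and contains y, so it is the whole ring. *)
Lemma quot_maximal_generated (I : right_ideal R) (u w : quot_mod I) :
  maximal_right_ideal I -> u != 0 -> exists c : R^c, w = c *: u.
Proof.
have [y <-] := quot_proj_surj u; have [z <-] := quot_proj_surj w.
case=> _ Imax; rewrite quot_proj_eq0 => Iy.
pose X (x : RR) := exists c : R^c, x - c *: y \in I.
have subX : submodule_prop X.
  split=> [|a s t [b Ib] [c Ic]].
    by exists 0; rewrite scale0r subr0 (rpred0 I).
  exists (a * b + c).
  have -> : a *: s + t - (a * b + c) *: y = a *: (s - b *: y) + (t - c *: y).
    by rewrite scalerBr scalerDl scalerA opprD addrACA.
  by apply: (rpredD (S := I)) => //; apply: (rpredZ (s := I)).
have IX : {subset I <= submod_of_prop subX}.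
  by move=> x Ix; apply/submod_of_propP; exists 0; rewrite scale0r subr0.
case: (Imax _ IX) => XE.
  case/negP: Iy; rewrite -XE; apply/submod_of_propP.
  by exists 1; rewrite scale1r subrr (rpred0 I).
have /submod_of_propP[c Ic] : z \in submod_of_prop subX by rewrite XE.
exists c; apply/eqP; rewrite -subr_eq0 -linearZ -raddfB quot_proj_eq0.
exact: Ic.
Qed.

(** If f x is nonzero it generates the simple module R/I, so the kernel of f
    together with x spans P; as x lies in a superfluous submodule, the kernel of
    f is then P, contradicting the choice of x. *)
Lemma superfluous_quot_maximal (P M : rmodType R) (p : {linear P -> M})
    (I : right_ideal R) (f : {linear P -> quot_mod I}) x :
  superfluous [pred x | p x == 0] -> maximal_right_ideal I ->
  p x = 0 -> f x = 0.
Proof.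
move=> Ksup Imax px; apply/eqP; apply: contraT => fx.
have subN : submodule_prop (fun v => f v = 0).
  by split=> [|a u v fu fv]; rewrite ?raddf0 // linearP fu fv scaler0 addr0.
have NT : submod_of_prop subN =i predT.
  apply: Ksup => v; have [c fv] := quot_maximal_generated (f v) Imax fx.
  exists (c *: x), (v - c *: x); split; last by rewrite addrC subrK.
    by rewrite inE linearZ_LR px scaler0.
  by apply/submod_of_propP; rewrite linearB linearZ_LR fv subrr.
have /submod_of_propP fx0 : x \in submod_of_prop subN by rewrite NT.
by rewrite fx0 eqxx in fx.
Qed.

End MaximalIdeals.

(** * The dual basis lemma *)

Section DualBasis.
Variables (R : pzRingType) (P : rmodType R).
Local Notation RR := (regular_rmod R).

Definition delta_fun (y z : P) : RR := if z == y then 1 else 0.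

(** The span of the pairs (y, delta_y) in P x R^P: the free module on the set P,
    seen as the graph of the summation map that sends delta_y to y.  In this
    form the summation map is the first projection, which is visibly linear. *)
Definition free_graph (v : P * (P -> RR)) : Prop :=
  exists l : seq (R^c * P), v = \sum_(i <- l) i.1 *: (i.2, delta_fun i.2).

Fact free_graph_submod : submodule_prop free_graph.
Proof.
split=> [|a u v [l1 ->] [l2 ->]]; first by exists [::]; rewrite big_nil.
exists ([seq (a * i.1, i.2) | i <- l1] ++ l2).
rewrite big_cat big_map scaler_sumr; congr (_ + _).
by apply: eq_bigr => i _; rewrite scalerA.
Qed.

Definition free_mod := submod_type (submod_of_prop free_graph_submod).

Lemma free_mod_proj_surj : surj (fst \o val : free_mod -> P).
Proof.
move=> y.
have Fy : (y, delta_fun y) \in submod_of_prop free_graph_submod.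
  apply/submod_of_propP; exists [:: (1, y)].
  by rewrite big_seq1 scale1r.
by exists (exist (fun v => v \in _) _ Fy).
Qed.

(** Projectivity yields a section of the first projection from the free module
    on P to P; the functional g y is its coordinate at y. *)
Lemma dual_basis : projective P ->
  exists g : P -> {linear P -> RR}, forall x, exists s : seq P,
    x = \sum_(y <- s) (g y x : R^c) *: y.
Proof.
move=> Pproj.
pose q : {linear free_mod -> P} := fst \o val.
have [h hK] := Pproj _ _ q idfun free_mod_proj_surj.
pose c y x : RR := (val (h x)).2 y.
have c_lin y : linear (c y).
  by move=> a u v; rewrite /c !linearP.
pose g y := HB.pack_for {linear P -> RR} (c y)
  (GRing.isLinear.Build _ _ _ _ (c y) (c_lin y)).
exists g => x; have /submod_of_propP[l hxE] := valP (h x).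
have cE y : c y x = \sum_(i <- l) (if y == i.2 then i.1 else 0).
  rewrite /c hxE (raddf_sum snd) /= fct_sumE; apply: eq_bigr => i _ /=.
  rewrite /delta_fun scalrfctE; case: eqP => _; rewrite ?scaler0 //.
  by rewrite scale_regularE mul1r.
(* The basis vectors of l may repeat, and c y x already gathers all the terms
   carried by y: hence undup. *)
exists (undup [seq i.2 | i <- l]).
rewrite -[LHS]hK /q /= hxE (raddf_sum fst) /=.
transitivity (\sum_(y <- undup [seq i.2 | i <- l])
                \sum_(i <- l) (if y == i.2 then i.1 else 0) *: y); last first.
  by apply: eq_bigr => y _; rewrite -scaler_suml -cE.
rewrite exchange_big /= [LHS]big_seq [RHS]big_seq; apply: eq_bigr => i li.
rewrite (bigD1_seq i.2) ?undup_uniq ?mem_undup ?map_f //= eqxx big1 ?addr0 //.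
by move=> y /negPf ->; rewrite scale0r.
Qed.

End DualBasis.

(** * Projective covers and max-projective modules *)

Section PerfectRings.
Variable R : pzRingType.
Local Notation RR := (regular_rmod R).

(** The quotient map R -> R/I factors as p o s, with s surjective since the
    kernel of p is superfluous, and s has a section t since P is projective.
    Then t o s is left multiplication by e = t (s 1); it maps I into the image
    under t of the kernel of p, and the image of a superfluous submodule is
    superfluous, hence inside J. *)
Lemma cover_complement_ideal (I : right_ideal R) (P : rmodType R)
    (p : {linear P -> quot_mod I}) :
  projective_cover p ->
  exists2 e : R, 1 - e \in I & forall x : R, x \in I -> jacobson (e * x).
Proof.
case=> Pproj p_surj Ksup; have [y py] := p_surj (quot_proj I 1).
have [s sE] := regular_free y.
have psE (x : RR) : p (s x) = quot_proj I x.
  rewrite sE linearZ_LR py -linearZ_LR; congr (quot_proj I _).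
  exact: (mul1r (x : R)).
have s_surj : surj s.
  have imP : submodule_prop (fun v => exists x, s x = v).
    split=> [|a u v [x <-] [z <-]]; first by exists 0; rewrite raddf0.
    by exists (a *: x + z); rewrite linearP.
  have imT : submod_of_prop imP =i predT.
    apply: Ksup => v; have [x xE] := quot_proj_surj (p v).
    exists (v - s x), (s x); split; last by rewrite subrK.
      by rewrite inE linearB psE xE subrr.
    by apply/submod_of_propP; exists x.
  by move=> v; have /submod_of_propP[x xE] : v \in submod_of_prop imP;
    [rewrite imT | exists x].
have [t tK] := Pproj _ _ s idfun s_surj.
exists (t y : R) => [|x Ix].
  have /eqP : quot_proj I ((1 : RR) - t y) = 0.
    by rewrite linearB /= -(psE (t y)) tK py subrr.
  by rewrite quot_proj_eq0.
move=> r; pose j : R := (t y : R) * (x * r).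
have tsE (z : R) : t (s z) = (t y : R) * z :> R by rewrite sE linear_regularZ.
(* This is the preimage under t of (1 - j) R; it is all of P, because t v
   differs from (1 - j) (t v) by j (t v), the image under t of an element of
   the kernel of p. *)
have NP : submodule_prop (fun v => exists z : R, t v = (1 - j) * z :> R).
  split=> [|a u v [z zE] [w wE]]; first by exists 0; rewrite raddf0 mulr0.
  exists (z * (a : R) + w).
  by rewrite linearD linear_regularZ zE wE mulrDr mulrA.
have NT : submod_of_prop NP =i predT.
  apply: Ksup => v; pose c : R := t v.
  exists (s (x * r * c : R)), (v - s (x * r * c : R)).
  split; last by rewrite addrC subrK.
    by rewrite inE psE quot_proj_eq0 -mulrA; exact: right_idealMr _ Ix.
  apply/submod_of_propP; exists c.
  by rewrite linearB tsE mulrBl mul1r /j !mulrA.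
(* So j = t (s (x r)) is of the form (1 - j) z, and 1 + z is a right inverse
   of 1 - j. *)
have /submod_of_propP[z zE] : s (x * r : R) \in submod_of_prop NP by rewrite NT.
exists (1 + z); rewrite mulrDr mulr1 -[(t y : R) * x * r]mulrA -/j -zE.
by rewrite tsE subrK.
Qed.

(** The set T of the t for which t g can be so approximated, for every g, is a
    right ideal because (t a) g = t (a g).  A maximal right ideal above T would
    contain the element e of cover_complement_ideal along with 1 - e. *)
Lemma functional_factors_mod_jacobson (P M : rmodType R) (p : {linear P -> M})
    (g : {linear P -> RR}) :
  right_perfect R -> max_projective M -> projective_cover p ->
  exists h : {linear M -> RR}, forall x, jacobson (g x - h (p x) : R).
Proof.
move=> Rperf Mmax [_ p_surj Ksup].
pose T (t : RR) := forall g : {linear P -> RR},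
  exists h : {linear M -> RR}, forall x, jacobson ((t : R) * g x - h (p x) : R).
have subT : submodule_prop T.
  split=> [g'|a u v Tu Tv g'].
    by exists \0 => x; rewrite mul0r subrr; apply: jacobson0.
  have [h hE] := Tu (lmul (a : R) \o g'); have [k kE] := Tv g'.
  exists (h \+ k) => x; rewrite scale_regularE mulrDl /= opprD addrACA.
  by apply: jacobsonD; [rewrite -mulrA; apply: hE | apply: kE].
have [/(submod_of_propP subT) T1|T1] := boolP ((1 : R) \in submod_of_prop subT).
  have [h hE] := T1 g; by exists h => x; rewrite -[g x](mul1r (_ : R)).
have [I Imax TI] := maximal_right_ideal_above T1.
have [Q [q qcover]] := Rperf (quot_mod I).
have [e eI eJ] := cover_complement_ideal qcover.
suff Te : e \in submod_of_prop subT.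
  case: Imax => IT _; case: IT => x; apply: right_ideal1.
  by rewrite -[1](subrK e); apply: (rpredD (S := I)) => //; apply: TI.
apply/(submod_of_propP subT) => {}g.
have [f fE] : exists f : {linear M -> quot_mod I},
    forall x, f (p x) = quot_proj I (g x).
  apply: (linear_factor (f := quot_proj I \o g) p_surj) => x.
  exact: (superfluous_quot_maximal _ Ksup Imax).
have [h hE] := Mmax I Imax f.
exists (lmul e \o h) => x; rewrite /= /lmul -mulrBr; apply: eJ.
have /eqP : quot_proj I (g x - h (p x)) = 0 by rewrite linearB /= hE fE subrr.
by rewrite quot_proj_eq0.
Qed.

(** Each functional of the dual basis of P agrees modulo J with one that kills
    the kernel of p, so the coordinates of x are combinations of themselves with
    coefficients in J, and Nakayama's lemma applies. *)
Lemma cover_of_max_projective_inj (P M : rmodType R) (p : {linear P -> M}) x :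
  right_perfect R -> max_projective M -> projective_cover p ->
  p x = 0 -> x = 0.
Proof.
move=> Rperf Mmax pcover px; have [Pproj _ _] := pcover.
have [g gE] := dual_basis Pproj; have [s xE] := gE x.
have [h hJ] := boolp.choice (fun y =>
  functional_factors_mod_jacobson (g y) Rperf Mmax pcover).
pose y i := nth 0 s i.
have a0 := @jacobson_nakayama R (size s) (fun i => g (y i) x)
  (fun i j => g (y i) (y j) - h (y i) (p (y j))).
rewrite xE (big_nth 0) big_mkord big1 // => i _.
rewrite a0 ?scale0r // => {}i _.
transitivity (g (y i) x - h (y i) (p x) : R); first by rewrite px raddf0 subr0.
rewrite {1 2}xE (big_nth 0) big_mkord !raddf_sum -big_split.
apply: eq_bigr => k _.
by rewrite /= !linearZ_LR /= -scalerDr.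
Qed.

Lemma projective_iso (P M : rmodType R) (p : {linear P -> M}) :
  surj p -> (forall x, p x = 0 -> x = 0) -> projective P -> projective M.
Proof.
move=> p_surj p_inj Pproj A B g f g_surj.
have [k kE] := Pproj A B g (f \o p) g_surj.
have [h hE] : exists h : {linear M -> A}, forall x, h (p x) = k x.
  by apply: linear_factor => // x /p_inj ->; rewrite raddf0.
by exists h => m; have [x <-] := p_surj m; rewrite hE kE.
Qed.

End PerfectRings.

Theorem corollary4 (R : pzRingType) (M : rmodType R) :
  right_perfect R ->
  [<-> projective M; R_projective M; max_projective M].
Proof.
move=> Rperf; tfae.
- by move=> Mproj I f; apply: Mproj; apply: quot_proj_surj.
- by move=> MR I _; apply: MR.
- move=> Mmax; have [P [p pcover]] := Rperf M; have [Pproj p_surj _] := pcover.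
  apply: projective_iso p_surj _ Pproj => x.
  exact: cover_of_max_projective_inj Rperf Mmax pcover.
Qed.
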